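(* For $n\in\mathbb{Z}$, define complex numbers $q^{(1,n)}_{k}$, $k\in\mathbb{Z}$, by the Laurent expansion $$\frac{e^{x}}{(e^x-1)^n}=\sum_{j\geq 0}q^{(1,n)}_{-n+j}\,x^{-n+j},$$ with $q^{(1,n)}_k=0$ for $k<-n$, and let $B_j$ be defined by $\frac{e^x}{e^x-1}=\sum_{j\geq 0}\frac{B_j}{j!}x^{j-1}$. Then for any $n\in\mathbb{Z}$, $q^{(1,n)}_{-n}=1$, and for every integer $j>0$, $$q^{(1,n)}_{-n+j}=-\frac{1}{j}\left(\frac{B_j}{j!}(n-j-1)+\sum_{i=1}^{j-1}i\,q^{(1,n+i-j)}_{j-n}\,q^{(1,-n-i+j+2)}_{n-2}\right).$$
   Context: The $B_j$ are the Bernoulli numbers with the convention $B_1=+\frac12$. Here $q^{(1,N)}_{k}$ denotes the coefficient of $x^k$ in the formal Laurent series of $e^x(e^x-1)^{-N}$, where $N$ may be any integer (positive, zero, or negative). *)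

(* Defs.v *)
From HB Require Import structures.
From mathcomp Require Import all_boot all_order all_algebra.
From mathcomp Require Import boolp classical_sets cardinality fsbigop reals complex.
From mathcomp Require Import zify.

Set Implicit Arguments.
Unset Strict Implicit.
Unset Printing Implicit Defensive.

Import Order.TTheory GRing.Theory Num.Theory.
Local Open Scope ring_scope.

(* The field F((x)) of formal Laurent series with finite principal part,     *)
(* with Leibniz equality (classical axioms of boolp).                         *)

Record laurent (F : fieldType) := Laurent {
  lcoef :> int -> F ;
  lcoef_bounded : exists N : int, forall k, k < N -> lcoef k = 0 }.

Section LaurentSeries.
Variable F : fieldType.
Implicit Types (f g h : laurent F) (a b c : nat -> F) (N M k : int) (i j : nat).

Definition lvanish N (u : int -> F) := forall k, k < N -> u k = 0.

Lemma laurent_eqP f g : (forall k, f k = g k) -> f = g.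
Proof.
case: f g => [u hu] [v hv] /= /funext uv.
by case: _ / uv hv => hv; congr Laurent; exact: Prop_irrelevance.
Qed.

(* The series \sum_(j >= 0) a j * x ^ (N + j). *)
Definition lseries_coef N a k : F := if N <= k then a `|k - N|%N else 0.

Lemma lseries_lt N a : lvanish N (lseries_coef N a).
Proof. by move=> k kN; rewrite /lseries_coef leNgt kN. Qed.

Definition lseries N a : laurent F :=
  Laurent (ex_intro _ N (@lseries_lt N a)).

Lemma lseriesE N a j : lseries N a (N + j%:Z) = a j.
Proof.
by rewrite /= /lseries_coef lerDl lez_nat /= [N + _]addrC addrK.
Qed.

Lemma ge_int_ex N k : N <= k -> exists j, k = N + j%:Z.
Proof. by move=> Nk; exists `|k - N|%N; lia. Qed.

Lemma lvanish_lseries N f : lvanish N f -> f = lseries N (fun j => f (N + j%:Z)).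
Proof.
move=> fN; apply: laurent_eqP => k; have [kN|/ge_int_ex[j ->]] := ltP k N.
  by rewrite fN //= lseries_lt.
by rewrite lseriesE.
Qed.

Lemma lvanish_le N M (u : int -> F) : M <= N -> lvanish N u -> lvanish M u.
Proof. by move=> MN uN k kM; apply: uN; exact: lt_le_trans MN. Qed.

Lemma eq_lseries N a b : a =1 b -> lseries N a = lseries N b.
Proof. by move=> /funext ->. Qed.

Definition lzero := lseries 0 (fun=> 0).

Lemma lopp_bounded f : exists N, lvanish N (fun k => - f k).
Proof. by have [N fN] := lcoef_bounded f; exists N => k /fN ->; rewrite oppr0. Qed.
Definition lopp f := Laurent (lopp_bounded f).

Lemma ladd_bounded f g : exists N, lvanish N (fun k => f k + g k).
Proof.
have [N fN] := lcoef_bounded f; have [M gM] := lcoef_bounded g.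
exists (Num.min N M) => k; rewrite lt_min => /andP[kN kM].
by rewrite fN // gM // addr0.
Qed.
Definition ladd f g := Laurent (ladd_bounded f g).

Definition lone := lseries 0 (fun j => (j == 0%N)%:R).

(* The sum over all i : int has finite support. *)
Definition lmul_coef (u v : int -> F) k : F :=
  \sum_(i \in [set: int]%classic) u i * v (k - i).

Lemma lmul_lt N M u v : lvanish N u -> lvanish M v -> lvanish (N + M) (lmul_coef u v).
Proof.
move=> uN vM k kNM; rewrite /lmul_coef fsbig1 // => i _.
have [iN|Ni] := ltP i N; first by rewrite uN ?mul0r.
by rewrite vM ?mulr0 //; lia.
Qed.

Lemma lmul_bounded f g : exists N, lvanish N (lmul_coef f g).
Proof.
have [N fN] := lcoef_bounded f; have [M gM] := lcoef_bounded g.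
by exists (N + M); exact: lmul_lt.
Qed.
Definition lmul f g := Laurent (lmul_bounded f g).

Definition cauchy a b j : F := \sum_(i < j.+1) a i * b (j - i)%N.

Lemma lmulE N M a b : lmul (lseries N a) (lseries M b) = lseries (N + M) (cauchy a b).
Proof.
apply: laurent_eqP => k; have [kNM|/ge_int_ex[j ->]] := ltP k (N + M).
  by rewrite /= (lmul_lt (@lseries_lt N a) (@lseries_lt M b)) // lseries_lt.
rewrite lseriesE /= /lmul_coef /cauchy.
have injS : injective (fun i : nat => N + i%:Z) by move=> x y /addrI[].
rewrite (fsbigE [seq N + i%:Z | i <- iota 0 j.+1]) //; last 2 first.
- by rewrite map_inj_uniq // iota_uniq.
- move=> i _ iN; have [iltN|/ge_int_ex[m im]] := ltP i N.
    by rewrite lseries_lt // mul0r.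
  have [mj|jm] := leqP m j; last by rewrite [X in _ * X]lseries_lt ?mulr0 //; lia.
  by case/negP: iN; rewrite im (mem_map injS) mem_iota; lia.
under eq_bigl do rewrite mem_setT.
rewrite big_map -[iota _ _]/(index_iota 0 j.+1) big_mkord.
apply: eq_bigr => i _; have ij := ltn_ord i.
rewrite [X in X * _](lseriesE N a i).
have -> : N + M + j%:Z - (N + i%:Z) = M + (j - i)%N%:Z by lia.
by rewrite [X in _ * X](lseriesE M b).
Qed.

Lemma cauchyE n a b j : (j < n)%N ->
  cauchy a b j = ((\poly_(i < n) a i) * (\poly_(i < n) b i))`_j.
Proof.
move=> jn; rewrite coefM; apply: eq_bigr => i _; have ij := ltn_ord i.
by rewrite !coef_poly !ifT //; lia.
Qed.

Lemma cauchyA a b c : cauchy a (cauchy b c) = cauchy (cauchy a b) c.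
Proof.
apply/funext => j; pose P d := \poly_(i < j.+1) d i : {poly F}.
transitivity (P a * (P b * P c))`_j.
  rewrite coefM; apply: eq_bigr => i _; have ij := ltn_ord i.
  by rewrite coef_poly ij (@cauchyE j.+1) //; lia.
rewrite mulrA coefM; apply: eq_bigr => i _; have ij := ltn_ord i.
by rewrite [(P c)`_ _]coef_poly ifT ?(@cauchyE j.+1) //; lia.
Qed.

Lemma cauchyC a b : cauchy a b = cauchy b a.
Proof. by apply/funext => j; rewrite !(@cauchyE j.+1) // mulrC. Qed.

Lemma laurent_lseries f : exists N a, f = lseries N a.
Proof. by have [N /lvanish_lseries ->] := lcoef_bounded f; exists N; eexists. Qed.

Lemma laddA : associative ladd.
Proof. by move=> f g h; apply: laurent_eqP => k /=; rewrite addrA. Qed.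
Lemma laddC : commutative ladd.
Proof. by move=> f g; apply: laurent_eqP => k /=; rewrite addrC. Qed.
Lemma lzeroE k : lzero k = 0.
Proof. by rewrite /= /lseries_coef; case: ifP. Qed.
Lemma ladd0r : left_id lzero ladd.
Proof. by move=> f; apply: laurent_eqP => k; rewrite -[LHS]/(lzero k + f k) lzeroE add0r. Qed.
Lemma laddNr : left_inverse lzero lopp ladd.
Proof. by move=> f; apply: laurent_eqP => k; rewrite lzeroE /= addNr. Qed.

Lemma lmulA : associative lmul.
Proof.
move=> f g h.
have [N [a ->]] := laurent_lseries f; have [M [b ->]] := laurent_lseries g.
by have [K [c ->]] := laurent_lseries h; rewrite !lmulE cauchyA addrA.
Qed.

Lemma lmulC : commutative lmul.
Proof.
move=> f g; have [N [a ->]] := laurent_lseries f; have [M [b ->]] := laurent_lseries g.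
by rewrite !lmulE cauchyC addrC.
Qed.

Lemma lmul1r : left_id lone lmul.
Proof.
move=> f; have [N [a ->]] := laurent_lseries f.
rewrite lmulE add0r; apply: eq_lseries => j.
rewrite /cauchy big_ord_recl /= mul1r subn0 big1 ?addr0 // => i _.
by rewrite mul0r.
Qed.

Lemma lmulDl : left_distributive lmul ladd.
Proof.
move=> f g h; have [N fN] := lcoef_bounded f; have [M gM] := lcoef_bounded g.
have [K [c ->]] := laurent_lseries h.
pose L := Num.min N M.
have LN : L <= N by rewrite ge_min lexx.
have LM : L <= M by rewrite ge_min lexx orbT.
rewrite (lvanish_lseries (lvanish_le LN fN)) (lvanish_lseries (lvanish_le LM gM)).
have lseriesD N' a' b' :
    ladd (lseries N' a') (lseries N' b') = lseries N' (fun j => a' j + b' j).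
  apply: laurent_eqP => k /=; rewrite /lseries_coef.
  by case: ifP => _; rewrite ?addr0.
rewrite lseriesD !lmulE lseriesD; apply: eq_lseries => j.
by rewrite /cauchy -big_split; apply: eq_bigr => i _; rewrite mulrDl.
Qed.

Lemma lone_neq0 : lone <> lzero.
Proof.
move=> /(congr1 (fun f : laurent F => f (0 + 0%:Z))); rewrite lzeroE.
by rewrite (lseriesE 0 _ 0) => /eqP; rewrite oner_eq0.
Qed.

HB.instance Definition _ := gen_eqMixin (laurent F).
HB.instance Definition _ := gen_choiceMixin (laurent F).
HB.instance Definition _ := GRing.isZmodule.Build (laurent F)
  laddA laddC ladd0r laddNr.

Lemma lone_neq0b : lone != 0 :> laurent F.
Proof. by apply/eqP; exact: lone_neq0. Qed.

HB.instance Definition _ := GRing.Zmodule_isComNzRing.Build (laurent F)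
  lmulA lmulC lmul1r lmulDl lone_neq0b.

(* A series with nonzero constant term is invertible. *)
Fixpoint cauchy_inv_seq a (n : nat) : seq F :=
  if n is m.+1 then
    let s := cauchy_inv_seq a m in
    rcons s ((a 0%N)^-1 * ((m == 0%N)%:R - \sum_(i < m) a (m - i)%N * s`_i))
  else [::].

Lemma size_cauchy_inv_seq a n : size (cauchy_inv_seq a n) = n.
Proof. by elim: n => //= n IHn; rewrite size_rcons IHn. Qed.

Lemma nth_cauchy_inv_seq a n i : (i < n)%N ->
  (cauchy_inv_seq a n)`_i = (cauchy_inv_seq a i.+1)`_i.
Proof.
elim: n => // n IHn; rewrite ltnS leq_eqVlt => /orP[/eqP -> //|lt_in].
by rewrite -IHn //= nth_rcons size_cauchy_inv_seq lt_in.
Qed.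

Lemma cauchy_inv a : a 0%N != 0 ->
  exists b, b 0%N != 0 /\ cauchy b a = (fun j => (j == 0%N)%:R).
Proof.
move=> a0; pose b j := (cauchy_inv_seq a j.+1)`_j.
have bE j : b j = (a 0%N)^-1 * ((j == 0%N)%:R - \sum_(i < j) a (j - i)%N * b i).
  rewrite /b /= nth_rcons size_cauchy_inv_seq ltnn eqxx; congr (_ * (_ - _)).
  by apply: eq_bigr => i _; rewrite nth_cauchy_inv_seq.
exists b; split.
  by rewrite bE big_ord0 subr0 mulr1 invr_eq0.
apply/funext => j; rewrite /cauchy big_ord_recr /= subnn [in X in _ + X]bE mulrAC.
rewrite mulVf // mul1r.
under eq_bigr do rewrite mulrC.
by rewrite addrC subrK.
Qed.

Lemma laurent_neq0 f : f != 0 -> exists N a, a 0%N != 0 /\ f = lseries N a.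
Proof.
move=> f0; have [N [a fE]] := laurent_lseries f.
have [j aj0] : exists j, a j != 0.
  apply: contrapT => /forallNP a0; case/eqP: f0; rewrite fE.
  have -> : a = (fun=> 0) by apply/funext => j; apply/eqP/negPn/negP/a0.
  by apply: laurent_eqP => k; rewrite lzeroE /= /lseries_coef; case: ifP.
have ex_a : exists j, a j != 0 by exists j.
case: (ex_minnP ex_a) => m am0 m_min.
exists (N + m%:Z), (fun j => f (N + m%:Z + j%:Z)); split.
  by rewrite addr0 fE lseriesE.
apply: lvanish_lseries => k kNm; rewrite fE.
have [kN|/ge_int_ex[l kE]] := ltP k N; first exact: lseries_lt.
rewrite kE lseriesE; apply/eqP/negPn/negP => /m_min ml; lia.
Qed.

Lemma lseries_inv_ex N a : a 0%N != 0 ->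
  exists b, b 0%N != 0 /\ lseries (- N) b * lseries N a = 1.
Proof.
move=> /cauchy_inv[b [b0 ba]]; exists b; split => //.
by rewrite [LHS]lmulE ba addNr.
Qed.

Definition linv f : laurent F :=
  if f == 0 then 0 else xget 0 [set g | g * f = 1]%classic.

Lemma lmulVf f : f != 0 -> linv f * f = 1.
Proof.
move=> f0; rewrite /linv (negbTE f0).
case: xgetP => [g _ //|noinv].
have [N [a [a0 fE]]] := laurent_neq0 f0.
by have [b [_]] := lseries_inv_ex N a0; rewrite -fE => /noinv.
Qed.

Lemma linv0 : linv 0 = 0.
Proof. by rewrite /linv eqxx. Qed.

HB.instance Definition _ := GRing.ComNzRing_isField.Build (laurent F) lmulVf linv0.

Lemma lseries_eq0 N a : a 0%N != 0 -> lseries N a != 0.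
Proof.
move=> a0; apply: contra a0 => /eqP /(congr1 (fun f : laurent F => f (N + 0%:Z))).
by rewrite lzeroE (lseriesE N a 0) => ->.
Qed.

Lemma lseriesV N a : a 0%N != 0 ->
  exists b, b 0%N != 0 /\ (lseries N a)^-1 = lseries (- N) b.
Proof.
move=> a0; have [b [b0 ba1]] := lseries_inv_ex N a0; exists b; split=> //.
apply: (mulIf (lseries_eq0 N a0)).
by rewrite ba1 mulVf ?lseries_eq0.
Qed.

Lemma lseriesM N M a b : lseries N a * lseries M b = lseries (N + M) (cauchy a b).
Proof. exact: lmulE. Qed.

Lemma lseriesXn N a n : exists b, lseries N a ^+ n = lseries (N * n%:Z) b.
Proof.
elim: n => [|n [b IHn]].
  by rewrite expr0 mulr0; eexists.
exists (cauchy a b); rewrite exprS IHn lseriesM; congr lseries.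
by rewrite -addn1 PoszD mulrDr mulr1 addrC.
Qed.

Lemma lseriesXz N a (n : int) : a 0%N != 0 ->
  exists b, lseries N a ^ n = lseries (N * n) b.
Proof.
move=> a0; case: n => n; first exact: lseriesXn.
have [c [_ aV]] := lseriesV N a0.
rewrite NegzE -exprnN -exprVn aV mulrN -mulNr; exact: lseriesXn.
Qed.

End LaurentSeries.

Section Expansions.
Variable F : numFieldType.

Definition lexp : laurent F := lseries 0 (fun j => j`!%:R^-1).

Lemma lexp_sub1 : lexp - 1 = lseries 1 (fun j => j.+1`!%:R^-1).
Proof.
apply: laurent_eqP => k.
rewrite -[lcoef (lexp - 1) k]/(lseries_coef 0 _ k - lseries_coef 0 _ k) /=.
rewrite /lseries_coef subr0.
case: k => [[|k]|k] //=; rewrite ?subr0 ?ler1n //.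
- by rewrite fact0 invr1 subrr.
- by congr (_`!%:R^-1); lia.
Qed.

(* The coefficient of x ^ k in e^x / (e^x - 1) ^ n; the superscript 1 of     *)
(* q^(1,n) is fixed. See q1_expansion below for the expansion from x ^ (- n). *)
Definition q1 (n k : int) : F := lcoef (lexp / (lexp - 1) ^ n) k.

(* e^x / (e^x - 1), not x / (e^x - 1): the convention B_1 = +1/2. *)
Definition bernoulli (j : nat) : F := j`!%:R * lcoef (lexp / (lexp - 1)) (j%:Z - 1).

Lemma q1_lt (n k : int) : k < - n -> q1 n k = 0.
Proof.
move=> kn; rewrite /q1 lexp_sub1 invr_expz.
have a0 : 1`!%:R^-1 != 0 :> F by rewrite invr_eq0 pnatr_eq0.
have [b ->] := @lseriesXz F 1 (fun j => j.+1`!%:R^-1) (- n) a0.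
by rewrite lseriesM add0r mul1r /= lseries_lt.
Qed.

Lemma q1_expansion (n : int) :
  lexp / (lexp - 1) ^ n = lseries (- n) (fun j => q1 n (- n + j%:Z)).
Proof. by apply: lvanish_lseries => k; exact: q1_lt. Qed.

Lemma bernoulli_expansion :
  lexp / (lexp - 1) = lseries (-1) (fun j => bernoulli j / j`!%:R).
Proof.
have := q1_expansion 1; rewrite expr1z => ->; apply: eq_lseries => j.
have j0 : j`!%:R != 0 :> F by rewrite pnatr_eq0 -lt0n fact_gt0.
by rewrite /bernoulli mulrC mulKf // /q1 expr1z addrC.
Qed.

End Expansions.

Arguments lexp : clear implicits.
Arguments q1 : clear implicits.
Arguments bernoulli : clear implicits.

(* Main.v *)
Require Import Defs.
From HB Require Import structures.
From mathcomp Require Import all_boot all_order all_algebra.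
From mathcomp Require Import reals complex.
From mathcomp Require Import zify.

Import Order.TTheory GRing.Theory Num.Theory.
Local Open Scope ring_scope.

(* Write u = e^x - 1, so u' = e^x, and Res for the coefficient of x^(-1). As   *)
(* Res (f') = 0, Res (u^m u') vanishes unless m = -1. Hence, for m = n - j - 1,  *)
(*   x^m = sum_(i <= j) a_i u^(m + i) + r,  a_i = Res (x^m u^(-m - i - 1) u'),   *)
(* with r of order > m + j, and a_i is q^(1,n+i-j)_(j-n). Then                   *)
(*   sum_i i a_i Res (x^(-m-j) u^(m+i-1) u')                                     *)
(*     = Res (x^(-m-j) ((x^m)' - m x^m u'/u)) = - m B_j / j!,                    *)
(* the contribution of r having nonnegative order. The second factor on the left *)
(* is q^(1,-n-i+j+2)_(n-2); for i = j it is 1 and a_j = q^(1,n)_(-n+j).          *)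

(** This is Lagrange inversion in truncated form. Under the residue pairing, the powers of u = e^x -
    1 are dual to the series u^(-m-1) u' ([lres_lexpM_lexp_sub1X]), so numbers [q1] are the
    coordinates of a monomial x^m in powers of u ([lmonom_lexp_sub1_expansion]). The operator f' - m
    f u'/u multiplies the i-th coordinate by i: it kills i = 0 and gives the unknown, at i = j, the
    weight j. Applied to x^m itself it leaves the Bernoulli term. Equating residues is [sum_q1M];
    [q1_recurrence] takes m = n - j - 1 and solves for the term i = j. No infinite sums in u are
    needed: remainders are controlled by their order. *)

Section LaurentCalculus.
Set Implicit Arguments.
Unset Strict Implicit.
Context {F : fieldType}.
Implicit Types (f g : laurent F) (N M k m : int) (c : F).

(** * Coefficients and the formal derivative *)

Definition lcoefp k f : F := lcoef f k.

Lemma lcoefp_is_zmod_morphism k : zmod_morphism (lcoefp k).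
Proof. by []. Qed.

HB.instance Definition _ k :=
  GRing.isZmodMorphism.Build (laurent F) F (lcoefp k) (lcoefp_is_zmod_morphism k).

Lemma lderiv_bounded f : exists N, lvanish N (fun k => f (k + 1) *~ (k + 1)).
Proof.
have [N fN] := lcoef_bounded f; exists (N - 1) => k kN.
by rewrite fN ?mul0rz //; lia.
Qed.

Definition lderiv f : laurent F := Laurent (lderiv_bounded f).

Lemma lderivE f k : lderiv f k = f (k + 1) *~ (k + 1).
Proof. by []. Qed.

Lemma lderiv_is_zmod_morphism : zmod_morphism lderiv.
Proof. by move=> f g; apply: laurent_eqP => k; rewrite /= mulrzBl. Qed.

HB.instance Definition _ :=
  GRing.isZmodMorphism.Build (laurent F) (laurent F) lderiv lderiv_is_zmod_morphism.

Lemma lres_lderiv f : lderiv f (-1) = 0.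
Proof. by rewrite lderivE addNr mulr0z. Qed.

Lemma lvanish_lderiv N f : lvanish (N + 1) f -> lvanish N (lderiv f).
Proof. by move=> fN k kN; rewrite lderivE fN ?mul0rz //; lia. Qed.

Lemma lderiv_lseries N (a : nat -> F) :
  lderiv (lseries N a) = lseries (N - 1) (fun j => a j *~ (N + j%:Z)).
Proof.
apply: laurent_eqP => k; have [kN|/ge_int_ex[j ->]] := ltP k (N - 1).
  by rewrite lderivE /= !lseries_lt ?mul0rz //; lia.
rewrite lseriesE lderivE.
have -> : N - 1 + j%:Z + 1 = N + j%:Z by lia.
by rewrite lseriesE.
Qed.

(** In each term of the Cauchy product the multiplicities N + i and M + (j - i) add up to N + M +
    j. *)
Lemma lderivM f g : lderiv (f * g) = lderiv f * g + f * lderiv g.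
Proof.
have [N [a ->]] := laurent_lseries f; have [M [b ->]] := laurent_lseries g.
rewrite lseriesM !lderiv_lseries !lseriesM.
have -> : N - 1 + M = N + M - 1 by lia.
have -> : N + (M - 1) = N + M - 1 by lia.
apply: laurent_eqP => k; rewrite -[RHS]/(lcoef _ k + lcoef _ k).
have [kN|/ge_int_ex[j ->]] := ltP k (N + M - 1).
  by rewrite /= !lseries_lt ?addr0.
rewrite !lseriesE /cauchy mulrz_suml -big_split; apply: eq_bigr => i _ /=.
have ij := ltn_ord i.
rewrite mulrzAl mulrzAr -mulrzDr; congr (_ *~ _); lia.
Qed.

Lemma lderiv1 : lderiv 1 = 0.
Proof.
apply: (addrI (lderiv 1)); rewrite addr0.
by have := lderivM 1 1; rewrite !mulr1 mul1r => <-.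
Qed.

(** The defect [E] of the formula satisfies E (k + 1) = E k * f and E 0 = 0; as f is nonzero, its
    vanishing propagates in both directions. *)
Lemma lderivXz f m : f != 0 -> lderiv (f ^ m) = f ^ (m - 1) * lderiv f *~ m.
Proof.
move=> f0; pose E k := lderiv (f ^ k) - f ^ (k - 1) * lderiv f *~ k.
have step k : E (k + 1) = E k * f.
  have fk : f ^ (k - 1) * f = f ^ k.
    by rewrite -[X in _ * X]expr1z -expfzDr // subrK.
  rewrite /E addrK expfzDr // expr1z lderivM mulrzDr mulr1z mulrBl mulrzAl.
  by rewrite mulrAC fk opprD addrACA subrr addr0.
suff: E m = 0 by move/eqP; rewrite subr_eq0 => /eqP.
elim/int_rec: m => [|k IHk|k IHk].
- by rewrite /E mulr0z subr0 expr0z lderiv1.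
- by rewrite -addn1 PoszD step IHk mul0r.
- have := step (- (k.+1)%:Z); rewrite (_ : _ + 1 = - k%:Z) ?IHk; last by lia.
  by move=> /esym/eqP; rewrite mulf_eq0 (negbTE f0) orbF => /eqP.
Qed.

(* x ^ N *)
Definition lmonom N : laurent F := lseries N (fun j => (j == 0%N)%:R).

Lemma lcoef_lmonom N k : lmonom N k = (k == N)%:R.
Proof.
have [kN|/ge_int_ex[j ->]] := ltP k N; first by rewrite [LHS]lseries_lt // lt_eqF.
by rewrite lseriesE; congr ((_ : bool)%:R); lia.
Qed.

Lemma lderiv_lmonom N : lderiv (lmonom N) = lmonom (N - 1) *~ N.
Proof.
rewrite lderiv_lseries; apply: laurent_eqP => k.
rewrite -[RHS]/(lcoefp k _) raddfMz /= /lseries_coef; case: ifP => _; last by rewrite mul0rz.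
by case: absz => [|j]; rewrite ?addr0 ?mul0rz.
Qed.

Lemma lcoef_lmonomM N f k : (lmonom N * f) k = f (k - N).
Proof.
have [M [a ->]] := laurent_lseries f; rewrite lseriesM.
have -> : cauchy (fun j => (j == 0%N)%:R) a = a.
  apply: boolp.funext => j; rewrite /cauchy big_ord_recl /= mul1r subn0 big1 ?addr0 // => i _.
  by rewrite mul0r.
by rewrite /= /lseries_coef; congr (if _ then _ else _); [lia|congr a; lia].
Qed.

Lemma lmonomM N M : lmonom N * lmonom M = lmonom (N + M).
Proof.
apply: laurent_eqP => k; rewrite lcoef_lmonomM /= /lseries_coef.
by congr (if _ then _ else _); [lia|congr ((_ == _)%:R); lia].
Qed.

(** Multiplication by this series serves as scalar multiplication. *)
Definition lconst c : laurent F := lseries 0 (fun j => c *+ (j == 0%N)).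

Lemma lcoef_lconstM c f k : (lconst c * f) k = c * f k.
Proof.
have [M [a ->]] := laurent_lseries f; rewrite lseriesM add0r.
have -> : cauchy (fun j => c *+ (j == 0%N)) a = (fun j => c * a j).
  apply: boolp.funext => j; rewrite /cauchy big_ord_recl /= mulr1n subn0 big1 ?addr0 // => i _.
  by rewrite mulr0n mul0r.
by rewrite /= /lseries_coef; case: ifP; rewrite ?mulr0.
Qed.

Lemma lderiv_lconstM c f : lderiv (lconst c * f) = lconst c * lderiv f.
Proof.
by apply: laurent_eqP => k; rewrite lcoef_lconstM !lderivE lcoef_lconstM mulrzAr.
Qed.

(** * Orders, leading coefficients, and expansion in powers of a series *)

Lemma lvanishM N M f g : lvanish N f -> lvanish M g -> lvanish (N + M) (f * g).
Proof. exact: lmul_lt. Qed.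

Lemma lvanishB N f g : lvanish N f -> lvanish N g -> lvanish N (f - g).
Proof.
by move=> fN gN k kN; rewrite -[LHS]/(f k - g k) fN ?gN ?subr0.
Qed.

Definition lmonic N f := lvanish N f /\ f N = 1.

Lemma lmonic_lmonom N : lmonic N (lmonom N).
Proof. by split; [exact: lseries_lt|rewrite /= /lseries_coef lexx subrr]. Qed.

Lemma lseries_lead N (a : nat -> F) : lseries N a N = a 0%N.
Proof. by rewrite /= /lseries_coef lexx subrr. Qed.

Lemma lcoefM_lead N M f g : lvanish N f -> lvanish M g -> (f * g) (N + M) = f N * g M.
Proof.
move=> /lvanish_lseries -> /lvanish_lseries ->.
by rewrite lseriesM !lseries_lead /cauchy big_ord1.
Qed.

Lemma lmonicM N M f g : lmonic N f -> lmonic M g -> lmonic (N + M) (f * g).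
Proof.
move=> [fN f1] [gM g1]; split; first exact: lvanishM.
by rewrite lcoefM_lead // f1 g1 mulr1.
Qed.

Lemma lmonic_neq0 N f : lmonic N f -> f != 0.
Proof.
move=> [_ f1]; apply/eqP => f0; move: f1; rewrite f0.
by rewrite -[LHS]/(lcoefp N 0) raddf0 => /esym/eqP; rewrite oner_eq0.
Qed.

Lemma lmonic1 : lmonic 0 1.
Proof. exact: lmonic_lmonom. Qed.

Lemma lmonicV N f : lmonic N f -> lmonic (- N) f^-1.
Proof.
move=> fm; have f0 := lmonic_neq0 fm; have [fN f1] := fm.
have a0 : f (N + 0%:Z) != 0 by rewrite addr0 f1 oner_eq0.
have fV : lvanish (- N) f^-1.
  rewrite (lvanish_lseries fN); have [b [_ ->]] := lseriesV N (a := fun j => f (N + j%:Z)) a0.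
  exact: lseries_lt.
split=> //; have := lcoefM_lead fN fV.
by rewrite divff // subrr f1 mul1r -[lcoef 1 0]/(1 : F) => <-.
Qed.

Lemma lmonicXz N f m : lmonic N f -> lmonic (N * m) (f ^ m).
Proof.
move=> fm; have fmX (k : nat) : lmonic (N * k%:Z) (f ^+ k).
  elim: k => [|k IHk]; first by rewrite mulr0; exact: lmonic1.
  rewrite exprS (_ : N * k.+1 = N + N * k); last by lia.
  exact: lmonicM.
case: m => k; first exact: fmX.
by rewrite NegzE mulrN -exprnN; apply: lmonicV.
Qed.

(** Greedy elimination: g^(N + n) is monic of order N + n, so subtracting the right multiple of it
    removes the lowest term of the remainder. *)
Lemma lmonic_expansion N f g (n : nat) : lvanish N f -> lmonic 1 g ->
  exists a : nat -> F,
    lvanish (N + n%:Z) (f - \sum_(i < n) lconst (a i) * g ^ (N + i%:Z)).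
Proof.
move=> fN gm; elim: n => [|n [a IHn]].
  by exists (fun=> 0); rewrite big_ord0 !subr0.
set r := f - _ in IHn; have [gN gN1] := lmonicXz (N + n%:Z) gm.
exists (fun i => if i == n then r (N + n%:Z) else a i).
have -> : f - \sum_(i < n.+1) lconst (if i == n :> nat then r (N + n%:Z) else a i) *
    g ^ (N + i%:Z) = r - lconst (r (N + n%:Z)) * g ^ (N + n%:Z).
  rewrite big_ord_recr opprD addrA; congr (_ - _ - _); last by rewrite eqxx.
  by apply: eq_bigr => i _; rewrite (ltn_eqF (ltn_ord i)).
rewrite mul1r in gN gN1 => k; rewrite -addn1 PoszD addrA => kn.
rewrite -[LHS]/(r k - (lconst _ * _) k) lcoef_lconstM.
have [kn'|nk] := ltP k (N + n%:Z).
  by rewrite IHn // gN // mulr0 subr0.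
have -> : k = N + n%:Z by lia.
by rewrite gN1 mulr1 subrr.
Qed.

End LaurentCalculus.

(** * Residues of e^x (e^x - 1)^m and the recurrence *)

Section ExpResidues.
Set Implicit Arguments.
Unset Strict Implicit.
Context {F : numFieldType}.
Implicit Types (n k m : int).

Lemma lmonic_lexp : lmonic 0 (lexp F).
Proof. by split; [exact: lseries_lt|rewrite /= /lseries_coef /= fact0 invr1]. Qed.

Lemma lmonic_lexp_sub1 : lmonic 1 (lexp F - 1).
Proof.
by rewrite lexp_sub1; split; [exact: lseries_lt|rewrite /= /lseries_coef /= invr1].
Qed.

Lemma lderiv_lexp : lderiv (lexp F) = lexp F.
Proof.
apply: laurent_eqP => k; rewrite lderivE.
have [k0|/ge_int_ex[j ->]] := ltP k 0.
  rewrite [RHS](lseries_lt _ k0); have [->|k1] := eqVneq k (-1); first by rewrite addNr mulr0z.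
  by rewrite [X in X *~ _]lseries_lt ?mul0rz //; lia.
have -> : 0 + j%:Z + 1 = 0 + j.+1%:Z by lia.
rewrite /lexp !lseriesE add0r factS natrM invfM.
by rewrite -mulrzr mulrAC mulVf ?mul1r // pnatr_eq0.
Qed.

Lemma lderiv_lexp_sub1 : lderiv (lexp F - 1) = lexp F.
Proof. by rewrite raddfB /= lderiv1 subr0 lderiv_lexp. Qed.

(** For m != -1, (m + 1) times the series is the derivative of (e^x - 1)^(m + 1), which has no
    residue, and characteristic zero allows cancelling m + 1. For m = -1 the residue is a leading
    coefficient. *)
Lemma lres_lexpM_lexp_sub1X m : (lexp F * (lexp F - 1) ^ m) (-1) = (m == -1)%:R.
Proof.
have [->|m1] := eqVneq m (-1).
  have [_] := lmonicM lmonic_lexp (lmonicXz (-1) lmonic_lexp_sub1).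
  by rewrite mul1r add0r.
have := lderivXz (m + 1) (lmonic_neq0 lmonic_lexp_sub1).
rewrite addrK lderiv_lexp_sub1 mulrC => /(congr1 (lcoefp (-1))).
rewrite [LHS]lres_lderiv raddfMz /= => /esym/eqP.
by rewrite mulrz_eq0 addr_eq0 (negbTE m1) => /eqP.
Qed.

Lemma q1_lres n k :
  q1 F n k = (lmonom (- k - 1) * (lexp F * (lexp F - 1) ^ (- n))) (-1).
Proof. by rewrite lcoef_lmonomM /q1 invr_expz; congr lcoef; lia. Qed.

Lemma q1_lead n : q1 F n (- n) = 1.
Proof.
have [_] := lmonicM lmonic_lexp (lmonicXz (- n) lmonic_lexp_sub1).
by rewrite add0r mul1r /q1 invr_expz.
Qed.

Lemma lmonom_lexp_sub1_expansion m (n : nat) :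
  lvanish (m + n%:Z) (lmonom m -
    \sum_(i < n) lconst (q1 F (m + i%:Z + 1) (- m - 1)) * (lexp F - 1) ^ (m + i%:Z)).
Proof.
have [a r0] := lmonic_expansion n (lmonic_lmonom m).1 lmonic_lexp_sub1.
rewrite [X in _ - X](_ : _ = \sum_(i < n) lconst (a i) * (lexp F - 1) ^ (m + i%:Z)) //.
apply: eq_bigr => i _; congr (lconst _ * _).
set r := lmonom m - _ in r0.
rewrite q1_lres (_ : - (- m - 1) - 1 = m); last by lia.
have -> : lmonom m = r + \sum_(l < n) lconst (a l) * (lexp F - 1) ^ (m + l%:Z).
  by rewrite /r subrK.
rewrite mulrDl -[LHS]/(lcoef _ _ + lcoef _ _).
(* Paired with e^x u^(-m-i-1), the remainder has order at least n - i - 1 >= 0, hence no residue. *)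
have [uN _] := lmonicM lmonic_lexp (lmonicXz (- (m + i%:Z + 1)) lmonic_lexp_sub1).
rewrite (lvanishM r0 uN) ?add0r; last by have := ltn_ord i; lia.
(* The l-th term pairs to a multiple of the residue of e^x u^(l-i-1), so only l = i survives. *)
rewrite mulr_suml -[LHS]/(lcoefp _ _) raddf_sum (bigD1 i) // big1 => [|l li].
  rewrite [LHS]addr0 -[LHS]/(lcoef _ _) -mulrA lcoef_lconstM mulrCA -expfzDr ?(lmonic_neq0 lmonic_lexp_sub1) //.
  by rewrite lres_lexpM_lexp_sub1X (_ : _ == _) ?mulr1 //; apply/eqP; lia.
rewrite -[LHS]/(lcoef _ _) -mulrA lcoef_lconstM mulrCA -expfzDr ?(lmonic_neq0 lmonic_lexp_sub1) //.
rewrite lres_lexpM_lexp_sub1X (_ : (_ == _) = false) ?mulr0 //.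
by move: li; rewrite -val_eqE /=; lia.
Qed.

Lemma sum_q1M m (j : nat) : (0 < j)%N ->
  \sum_(i < j.+1) q1 F (m + i%:Z + 1) (- m - 1) * q1 F (1 - m - i%:Z) (m + j%:Z - 1) *~ i
  = - q1 F 1 (j%:Z - 1) *~ m.
Proof.
move=> j0; set u := lexp F - 1; have u0 : u != 0 := lmonic_neq0 lmonic_lexp_sub1.
pose A i := q1 F (m + i%:Z + 1) (- m - 1).
have := @lmonom_lexp_sub1_expansion m j.+1; rewrite -/u.
set S := (X in lmonom m - X) => rN; set r := lmonom m - S in rN.
have SE : S = lmonom m - r by rewrite /r opprB addrC subrK.
(* L f = f' - m f u'/u sends u^(m+i) to i u^(m+i-1) u'. *)
pose L (f : laurent F) := lderiv f - f * (lexp F * u ^ (-1)) *~ m.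
have LS : L S = \sum_(i < j.+1) lconst (A i) * (lexp F * u ^ (m + i%:Z - 1)) *~ i.
  rewrite /L raddf_sum mulr_suml mulrz_suml -sumrB; apply: eq_bigr => i _ /=.
  have e : u ^ (m + i%:Z) * (lexp F * u ^ (-1)) = lexp F * u ^ (m + i%:Z - 1).
    by rewrite mulrCA -expfzDr.
  rewrite lderiv_lconstM lderivXz // lderiv_lexp_sub1 -/(A i) mulrzAr.
  rewrite [u ^ _ * lexp F]mulrC -mulrA e -mulrzBr.
  by congr (_ *~ _); lia.
(* The j + 1 terms leave r of order at least m + j + 1; both differentiation and multiplication by
   u'/u lower this bound by one. So x^(-m-j) L r has no residue. *)
have Lr : lvanish (m + j%:Z) (L r).
  apply: lvanishB; first by apply: lvanish_lderiv; move: rN; rewrite -addn1 PoszD addrA.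
  move=> k kN; rewrite -[LHS]/(lcoefp k _) raddfMz.
  have [uN _] := lmonicM lmonic_lexp (lmonicXz (-1) lmonic_lexp_sub1).
  by rewrite [X in X *~ _](lvanishM rN uN) ?mul0rz //; lia.
pose R (f : laurent F) := (lmonom (- m - j%:Z) * f) (-1).
have -> : - q1 F 1 (j%:Z - 1) *~ m = R (L S).
  have -> : L S = L (lmonom m) - L r.
    rewrite SE /L raddfB mulrBl mulrzBl !opprB.
    by rewrite [LHS]addrACA [RHS]addrACA [X in _ + X = _]addrC.
  rewrite /R mulrBr -[RHS]/(lcoef _ _ - lcoef _ _).
  rewrite [X in _ = _ - X]lcoef_lmonomM Lr ?subr0; last by lia.
  have Dx : lmonom (- m - j%:Z) * lderiv (lmonom m) = lmonom (- j%:Z - 1) *~ m :> laurent F.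
    by rewrite lderiv_lmonom mulrzAr lmonomM (_ : _ + (m - 1) = - j%:Z - 1) //; lia.
  have xE : lmonom (- m - j%:Z) * (lmonom m * (lexp F * u ^ (-1)) *~ m) =
      lmonom (- j%:Z) * (lexp F * u ^ (-1)) *~ m.
    by rewrite mulrzAr (mulrA (lmonom (- m - j%:Z))) lmonomM (_ : _ - j%:Z + m = - j%:Z) //; lia.
  rewrite /L mulrBr Dx xE -[RHS]/(lcoefp _ _ - lcoefp _ _) !raddfMz.
  rewrite -[RHS]/(lcoef _ _ *~ _ + (- lcoef _ _) *~ _) lcoef_lmonom.
  (* Here j > 0 matters: the derivative of x^m contributes m x^(-j-1), which has no residue. *)
  rewrite (_ : (_ == _) = false); last by lia.
  rewrite mul0rz add0r q1_lres.
  by rewrite (_ : - (j%:Z - 1) - 1 = - j%:Z) //; lia.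
rewrite LS /R mulr_sumr -[RHS]/(lcoefp _ _) raddf_sum; apply: eq_bigr => i _.
rewrite mulrzAr raddfMz mulrCA [X in _ = X *~ _]lcoef_lconstM.
rewrite [X in _ * X *~ _ = _]q1_lres.
rewrite (_ : - (m + j%:Z - 1) - 1 = - m - j%:Z); last by lia.
rewrite (_ : - (1 - m - i%:Z) = m + i%:Z - 1) //; last by lia.
Qed.
Lemma q1_recurrence n (j : nat) : (0 < j)%N ->
  q1 F n (- n + j%:Z) =
    - (j%:R)^-1 *
      (bernoulli F j / j`!%:R * (n - j%:Z - 1)%:~R +
       \sum_(1 <= i < j)
         i%:R * q1 F (n + i%:Z - j%:Z) (j%:Z - n) *
                q1 F (- n - i%:Z + j%:Z + 2) (n - 2)).
Proof.
move=> j0; have Bj : bernoulli F j / j`!%:R = q1 F 1 (j%:Z - 1).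
  have fj : j`!%:R != 0 :> F by rewrite pnatr_eq0 -lt0n fact_gt0.
  by rewrite /bernoulli mulrC mulKf // /q1 expr1z.
pose t (i : nat) : F := i%:R * q1 F (n + i%:Z - j%:Z) (j%:Z - n) *
  q1 F (- n - i%:Z + j%:Z + 2) (n - 2).
have t0 : t 0%N = 0 by rewrite /t !mul0r.
have tj : t j = j%:R * q1 F n (- n + j%:Z).
  rewrite /t (_ : n + j%:Z - j%:Z = n); last by lia.
  rewrite (_ : - n - j%:Z + j%:Z + 2 = - (n - 2)); last by lia.
  by rewrite -[X in q1 _ (- _) X]opprK q1_lead mulr1 addrC.
(* This is [sum_q1M] at m = n - j - 1, with its zero term i = 0 dropped. *)
have sum_t : \sum_(1 <= i < j) t i + t j = - q1 F 1 (j%:Z - 1) * (n - j%:Z - 1)%:~R.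
  rewrite -big_nat_recr // mulrzr -sum_q1M // -(big_mkord xpredT (fun i : nat =>
    q1 F (n - j%:Z - 1 + i%:Z + 1) (- (n - j%:Z - 1) - 1) *
    q1 F (1 - (n - j%:Z - 1) - i%:Z) (n - j%:Z - 1 + j%:Z - 1) *~ i)).
  rewrite [RHS]big_ltn // mulr0z [RHS]add0r; apply: eq_big_nat => i _.
  rewrite /t -mulrA mulr_natl.
  rewrite (_ : n - j%:Z - 1 + i%:Z + 1 = n + i%:Z - j%:Z); last by lia.
  rewrite (_ : 1 - (n - j%:Z - 1) - i%:Z = - n - i%:Z + j%:Z + 2); last by lia.
  rewrite (_ : n - j%:Z - 1 + j%:Z - 1 = n - 2); last by lia.
  by rewrite (_ : - (n - j%:Z - 1) - 1 = j%:Z - n) //; lia.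
have nzj : j%:R != 0 :> F by rewrite pnatr_eq0 -lt0n.
rewrite Bj -/(t _); set s := \sum_(1 <= i < j) _.
have -> : s = - (q1 F 1 (j%:Z - 1) * (n - j%:Z - 1)%:~R) - t j.
  by rewrite -mulNr -sum_t addrK.
by rewrite addrA subrr sub0r mulrNN tj mulKf.
Qed.

End ExpResidues.

Theorem theorem3p1 (R : realType) (n : int) :
  q1 R[i] n (- n) = 1 /\
  forall j : nat, (0 < j)%N ->
    q1 R[i] n (- n + j%:Z) =
    - (j%:R)^-1 *
      (bernoulli R[i] j / j`!%:R * (n - j%:Z - 1)%:~R +
       \sum_(1 <= i < j)
         i%:R * q1 R[i] (n + i%:Z - j%:Z) (j%:Z - n) *
                q1 R[i] (- n - i%:Z + j%:Z + 2) (n - 2)).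
Proof.
by split=> [|j]; [exact: q1_lead|exact: q1_recurrence].
Qed.
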